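(* Let $(G,B)$ be a connected finite graph with boundary equipped with the unit weight. Then, for $i=2,3,\dots,|\Omega|$: (1) $\nu_2\ge2e(G)\left(1-\cos\frac{\pi}{|V|}\right)$; (2) $\nu_i\ge2e(\Omega)\left(1-\cos\frac{\pi}{|\Omega|}\right)+\lambda_{i-1}\left(\operatorname{Deg}_B\cdot I_\Omega-A_BL_B^{-1}A_\Omega\right)$; (3) $\lambda_i\ge2e(\Omega)\left(1-\cos\frac{\pi}{|\Omega|}\right)+\operatorname{Deg}_B^{(i-1)}$; (4) $\lambda_i\ge2e(G)\left(1-\cos\frac{\pi}{|V|}\right)+\lambda_{i-1}\left(A_BL_B^{-1}A_\Omega\right)$. Here $e(G)$ is the edge connectivity of $G$ and $e(\Omega)$ is the edge connectivity of the induced subgraph $G|_\Omega$.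
   Context: All graphs are finite and simple. A graph with boundary $(G,B)$ is a graph $G$ with vertex set $V$ and edge set $E$ together with a nonempty subset $B\subset V$ (the boundary); $\Omega=V\setminus B$ is the interior. The unit weight means vertex-measure $m\equiv1$ and edge-weight $w\equiv1$ on $E$ (and $w_{xy}=0$ if $\{x,y\}\notin E$). $\mathbb{R}^S$ is the space of real functions on $S$ with the standard inner product. The edge connectivity of a graph is the least number of edges that need to be deleted to make it disconnected (it is $0$ for a disconnected graph). For $x\in\Omega$, $\operatorname{Deg}_B(x)=\sum_{y\in B}w_{xy}$; $\operatorname{Deg}_B^{(1)}\le\dots\le\operatorname{Deg}_B^{(|\Omega|)}$ is the nondecreasing rearrangement of these values over $x\in\Omega$; $\operatorname{Deg}_B\cdot I_\Omega$ is multiplication by $\operatorname{Deg}_B$ on $\mathbb{R}^\Omega$. Laplacian: $\Delta u(x)=\sum_{y\in V}(u(x)-u(y))w_{xy}$ for $u\in\mathbb{R}^V$. Dirichlet Laplacian: for $u\in\mathbb{R}^\Omega$ let $E_0(u)\in\mathbb{R}^V$ be its extension by $0$ on $B$, and $\Delta^Du=(\Delta E_0(u))|_\Omega$, a nonnegative self-adjoint operator on $\mathbb{R}^\Omega$ with eigenvalues (Dirichlet eigenvalues), counted with multiplicity, $0\le\lambda_1\le\dots\le\lambda_{|\Omega|}$. Neumann Laplacian: for $u\in\mathbb{R}^\Omega$, let $N_0(u)\in\mathbb{R}^V$ be the unique function with $N_0(u)=u$ on $\Omega$ and $\Delta N_0(u)=0$ on $B$. Set $\Delta^N u=(\Delta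 N_0(u))|_\Omega$, a nonnegative self-adjoint operator on $\mathbb{R}^\Omega$ with eigenvalues (Neumann eigenvalues), counted with multiplicity, $0\le\nu_1\le\dots\le\nu_{|\Omega|}$. Adjacency operators: $A_B:\mathbb{R}^B\to\mathbb{R}^\Omega$, $A_Bu(x)=\sum_{y\in B}u(y)w_{xy}$ for $x\in\Omega$, and $A_\Omega:\mathbb{R}^\Omega\to\mathbb{R}^B$, $A_\Omega u(x)=\sum_{y\in\Omega}u(y)w_{xy}$ for $x\in B$. $L_B:\mathbb{R}^B\to\mathbb{R}^B$ is $L_Bf=(\Delta\tilde f)|_B$, where $\tilde f$ is the extension of $f$ by $0$ on $\Omega$; it is invertible. For a self-adjoint operator $T$, $\lambda_1(T)\le\lambda_2(T)\le\cdots$ are its eigenvalues counted with multiplicity (whereas $\lambda_i$ without argument is a Dirichlet eigenvalue). *)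

(* Defs.v *)
From HB Require Import structures.
From mathcomp Require Import all_boot all_order all_algebra.
From mathcomp Require Import boolp classical_sets reals trigo.
From mathcomp Require polyrcf.

Set Implicit Arguments.
Unset Strict Implicit.
Unset Printing Implicit Defensive.

Import Order.TTheory GRing.Theory Num.Theory passmx.
Local Open Scope ring_scope.

(* A finite simple graph is a symmetric irreflexive [e : rel V] on a finType. *)

Definition connected_graph (V : finType) (e : rel V) : bool :=
  [forall x, forall y, connect e x y].

Definition edge_set (V : finType) (e : rel V) : {set {set V}} :=
  [set F : {set V} | [exists x, exists y, e x y && (F == [set x; y])]].

Definition delete_edges (V : finType) (e : rel V) (F : {set {set V}}) : rel V :=
  fun x y => e x y && ([set x; y] \notin F).

(* On at most one vertex no deletion disconnects the graph, and the default of
   [arg min] makes the value 0; otherwise deleting all the edges is a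
   candidate, so that the minimum is a genuine one (see edge_connectivityP). *)
Definition edge_connectivity (V : finType) (e : rel V) : nat :=
  #|[arg min_(F < edge_set e | (F \subset edge_set e) &&
        ~~ connected_graph (delete_edges e F)) #|F|]|.

Definition induced (V : finType) (e : rel V) (P : pred V) : rel {x : V | P x} :=
  fun x y => e (val x) (val y).
Arguments induced {V} e P x y.

Section Spectrum.
Variables (R : realType) (vT : vectType R).
Implicit Types (T : 'End(vT)) (s : seq R).

Definition is_spectrum T s : Prop :=
  sorted <=%R s /\ forall a : R, count_mem a s = \dim (leigenspace T a).

Definition spectrum T : seq R := xget [::] [set s | is_spectrum T s]%classic.

(* The i-th smallest eigenvalue, with indices starting at 1. *)
Definition eigval T (i : nat) : R := nth 0 (spectrum T) i.-1.

End Spectrum.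

Section GraphWithBoundary.
Variables (R : realType) (V : finType) (e : rel V) (B : {set V}).

Definition bdry : finType := {x : V | x \in B}.
Definition Omega : finType := {x : V | x \notin B}.

Definition induced_Omega : rel Omega := induced e (fun x => x \notin B).

Definition weight (x y : V) : R := (e x y)%:R.

Definition Deg_B (x : Omega) : R := \sum_(y in B) weight (val x) y.

(* Nondecreasing rearrangement of Deg_B, with indices starting at 1. *)
Definition Deg_B_sorted (i : nat) : R :=
  nth 0 (sort <=%R [seq Deg_B x | x : Omega]) i.-1.

(* [R^o] is R as a one-dimensional vector space over itself. *)
Definition ext0 (P : pred V) (u : {ffun {x : V | P x} -> R^o}) :
    {ffun V -> R^o} :=
  [ffun x => oapp u 0 (insub x : option {x : V | P x})].

Definition restr (P : pred V) (u : {ffun V -> R^o}) :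
    {ffun {x : V | P x} -> R^o} :=
  [ffun x => u (val x)].

Definition laplacian (u : {ffun V -> R^o}) : {ffun V -> R^o} :=
  [ffun x => \sum_y (u x - u y) * weight x y].

Definition dirichlet_laplacian (u : {ffun Omega -> R^o}) :
    {ffun Omega -> R^o} :=
  restr (fun x => x \notin B) (laplacian (ext0 u)).

Definition is_neumann_ext (u : {ffun Omega -> R^o}) (v : {ffun V -> R^o}) :
    Prop :=
  (forall x : Omega, v (val x) = u x) /\ (forall x, x \in B -> laplacian v x = 0).

Definition N0 (u : {ffun Omega -> R^o}) : {ffun V -> R^o} :=
  xget 0 [set v | is_neumann_ext u v]%classic.

Definition neumann_laplacian (u : {ffun Omega -> R^o}) : {ffun Omega -> R^o} :=
  restr (fun x => x \notin B) (laplacian (N0 u)).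

Definition A_B (u : {ffun bdry -> R^o}) : {ffun Omega -> R^o} :=
  [ffun x => \sum_(y : bdry) u y * weight (val x) (val y)].

Definition A_Omega (u : {ffun Omega -> R^o}) : {ffun bdry -> R^o} :=
  [ffun x => \sum_(y : Omega) u y * weight (val x) (val y)].

Definition L_B (f : {ffun bdry -> R^o}) : {ffun bdry -> R^o} :=
  restr (fun x => x \in B) (laplacian (ext0 f)).

Definition Deg_B_mul (u : {ffun Omega -> R^o}) : {ffun Omega -> R^o} :=
  [ffun x => Deg_B x * u x].

(* [linfun] turns a function which is linear into an element of 'End or 'Hom;
   linearity is proved below, for N0 on connected graphs (N0_linear). *)
Definition Dirichlet : 'End({ffun Omega -> R^o}) := linfun dirichlet_laplacian.
Definition Neumann : 'End({ffun Omega -> R^o}) := linfun neumann_laplacian.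

Definition DegI : 'End({ffun Omega -> R^o}) := linfun Deg_B_mul.

(* [^-1%VF] is the inverse since L_B is bijective (lker_L_B). *)
Definition ALA : 'End({ffun Omega -> R^o}) :=
  (linfun A_B \o (linfun L_B)^-1 \o linfun A_Omega)%VF.

End GraphWithBoundary.

Arguments induced_Omega {V} e B x y.
Arguments Deg_B_sorted R {V} e B i.
Arguments Dirichlet R {V} e B.
Arguments Neumann R {V} e B.
Arguments DegI R {V} e B.
Arguments ALA R {V} e B.

Lemma edge_connectivityP (V : finType) (e : rel V) : (1 < #|V|)%N ->
  exists F : {set {set V}}, [/\ F \subset edge_set e,
    ~~ connected_graph (delete_edges e F), #|F| = edge_connectivity e &
    forall F' : {set {set V}}, F' \subset edge_set e ->
      ~~ connected_graph (delete_edges e F') -> (#|F| <= #|F'|)%N].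
Proof.
move=> V1; rewrite /edge_connectivity; case: arg_minnP => [|F /andP[sF dF] minF].
  rewrite subxx /=; apply/negP => /forallP conn.
  have /card_gt1P[x [y [_ _ xy]]] := V1.
  have /forallP/(_ y)/connectP[[|z p] /= + yl] := conn x.
    by rewrite yl eqxx in xy.
  case/andP => /andP[exz]; rewrite inE => /negP[].
  by apply/existsP; exists x; apply/existsP; exists z; rewrite exz eqxx.
exists F; split => // F' sF' dF'; apply: minF; exact/andP.
Qed.

Lemma is_spectrum_unique (R : realType) (vT : vectType R) (T : 'End(vT)) s s' :
  is_spectrum T s -> is_spectrum T s' -> s = s'.
Proof.
move=> [ss cs] [ss' cs']; apply: (sorted_eq le_trans le_anti ss ss').
by apply/allP => x _ /=; rewrite cs cs'.
Qed.

Lemma spectrumP (R : realType) (vT : vectType R) (T : 'End(vT)) :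
  is_spectrum T (spectrum T).
Proof.
apply: (@xgetPex (seq R)).
pose e := vbasis (fullv : {vspace vT}).
have eb : basis_of fullv e by exact: vbasisP.
pose r := polyrcf.rootsR (char_poly (mxof e e T)).
have ur : uniq r.
  exact/(sorted_uniq lt_trans ltxx)/polyrcf.sorted_roots.
pose s := flatten [seq nseq (\dim (leigenspace T a)) a | a <- r].
exists (sort <=%R s); split; first exact: (sort_sorted le_total).
move=> a; rewrite count_sort /s count_flatten -map_comp sumnE big_map.
rewrite (eq_bigr (fun b => if b == a then \dim (leigenspace T a) else 0%N));
  last by move=> b _ /=; rewrite count_nseq /=; case: eqP => [->|_];
          rewrite ?mul1n ?mul0n.
rewrite -big_mkcond /=; have [ar|ar] := boolP (a \in r).
  by rewrite -big_filter filter_pred1_uniq // big_seq1.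
rewrite big_seq_cond big1; last first.
  by move=> b /andP[br /eqP ba]; rewrite -ba br in ar.
apply/esym/eqP; apply: contraNT ar => d0.
have : eigenvalue (mxof e e T) a.
  apply: contraNN d0 => /eqP K0.
  rewrite (leigenspaceE eb) K0.
  by rewrite dimv_eq0 vsof_eq0.
rewrite eigenvalue_root_char => Ra.
have := polyrcf.roots_on_rootsR (monic_neq0 (char_poly_monic (mxof e e T))).
by move=> /(_ a); rewrite in_itv /= Ra => <-.
Qed.

Section Linearity.
Variables (R : realType) (V : finType) (e : rel V) (B : {set V}).

Fact ext0_linear (P : pred V) : linear (@ext0 R V P).
Proof.
move=> a u v; apply/ffunP => x; rewrite !ffunE.
by case: insubP => [y _ _|_] /=; rewrite ?ffunE ?scaler0 ?addr0.
Qed.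
HB.instance Definition _ (P : pred V) :=
  GRing.isLinear.Build R _ _ *:%R (@ext0 R V P) (@ext0_linear P).

Fact restr_linear (P : pred V) : linear (@restr R V P).
Proof. by move=> a u v; apply/ffunP => x; rewrite !ffunE. Qed.
HB.instance Definition _ (P : pred V) :=
  GRing.isLinear.Build R _ _ *:%R (@restr R V P) (@restr_linear P).

Fact laplacian_linear : linear (@laplacian R V e).
Proof.
move=> a u v; apply/ffunP => x; rewrite !ffunE scaler_sumr -big_split /=.
apply: eq_bigr => y _; rewrite !ffunE /GRing.scale /= mulrA -mulrDl.
by rewrite opprD addrACA -mulrBr.
Qed.
HB.instance Definition _ :=
  GRing.isLinear.Build R _ _ *:%R (@laplacian R V e) laplacian_linear.

Fact dirichlet_laplacian_linear : linear (@dirichlet_laplacian R V e B).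
Proof. by move=> a u v; rewrite /dirichlet_laplacian !linearP. Qed.
HB.instance Definition _ := GRing.isLinear.Build R _ _ *:%R
  (@dirichlet_laplacian R V e B) dirichlet_laplacian_linear.

Fact L_B_linear : linear (@L_B R V e B).
Proof. by move=> a u v; rewrite /L_B !linearP. Qed.
HB.instance Definition _ :=
  GRing.isLinear.Build R _ _ *:%R (@L_B R V e B) L_B_linear.

Fact A_B_linear : linear (@A_B R V e B).
Proof.
move=> a u v; apply/ffunP => x; rewrite !ffunE scaler_sumr -big_split /=.
by apply: eq_bigr => y _; rewrite !ffunE /GRing.scale /= mulrA -mulrDl.
Qed.
HB.instance Definition _ :=
  GRing.isLinear.Build R _ _ *:%R (@A_B R V e B) A_B_linear.

Fact A_Omega_linear : linear (@A_Omega R V e B).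
Proof.
move=> a u v; apply/ffunP => x; rewrite !ffunE scaler_sumr -big_split /=.
by apply: eq_bigr => y _; rewrite !ffunE /GRing.scale /= mulrA -mulrDl.
Qed.
HB.instance Definition _ :=
  GRing.isLinear.Build R _ _ *:%R (@A_Omega R V e B) A_Omega_linear.

Fact Deg_B_mul_linear : linear (@Deg_B_mul R V e B).
Proof.
move=> a u v; apply/ffunP => x; rewrite !ffunE /GRing.scale /= mulrDr.
by rewrite mulrCA.
Qed.
HB.instance Definition _ :=
  GRing.isLinear.Build R _ _ *:%R (@Deg_B_mul R V e B) Deg_B_mul_linear.

End Linearity.

Section Neumann.
Variables (R : realType) (V : finType) (e : rel V) (B : {set V}).
Hypotheses (sym_e : symmetric e) (conn_e : connected_graph e).
Hypothesis Omega_neq0 : (0 < #|Omega B|)%N.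

Let harmonic_eq0 (g : {ffun V -> R^o}) : (forall x, x \notin B -> g x = 0) ->
  (forall x, x \in B -> laplacian e g x = 0) -> g = 0.
Proof.
move=> g0 Lg0.
pose D x y : R := (g x - g y) ^+ 2 * weight R e x y.
have wC x y : weight R e x y = weight R e y x by rewrite /weight sym_e.
have energy : \sum_x \sum_y D x y = 0.
  have E0 : \sum_x \sum_y (g x * ((g x - g y) * weight R e x y)) = 0 :> R.
    rewrite big1 // => x _; rewrite -mulr_sumr.
    have [xB|xB] := boolP (x \in B); last by rewrite g0 // mul0r.
    by have := Lg0 x xB; rewrite ffunE => ->; rewrite mulr0.
  have E1 : \sum_x \sum_y (g y * ((g x - g y) * weight R e x y)) = 0 :> R.
    rewrite exchange_big /= -[RHS]oppr0 -[in RHS]E0 -sumrN.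
    apply: eq_bigr => x _; rewrite -sumrN; apply: eq_bigr => y _.
    by rewrite wC -mulrN -mulNr opprB.
  rewrite -[RHS]subr0 -[X in _ = X - _]E0 -[X in _ = _ - X]E1 -sumrB.
  apply: eq_bigr => x _; rewrite -sumrB; apply: eq_bigr => y _.
  by rewrite -mulrBl mulrA -expr2.
have D0 x y : 0 <= D x y by rewrite mulr_ge0 ?sqr_ge0 ?ler0n.
have const x y : e x y -> g x = g y.
  move=> exy.
  have s0 : \sum_y D x y = 0.
    by apply: (psumr_eq0P _ energy) => // z _; apply: sumr_ge0.
  have /eqP : D x y = 0 by apply: (psumr_eq0P _ s0).
  by rewrite /D /weight exy mulr1 sqrf_eq0 subr_eq0 => /eqP.
have gconst x y : g x = g y.
  have /forallP/(_ y)/connectP[p + ->] := forallP conn_e x.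
  by elim: p x => //= z p IHp x /andP[/const-> /IHp].
have /card_gt0P[z _] := Omega_neq0.
by apply/ffunP => x; rewrite (gconst x (val z)) g0 ?ffunE ?(valP z).
Qed.

Lemma lker_L_B : lker (linfun (@L_B R V e B)) == 0%VS.
Proof.
rewrite -subv0; apply/subvP => f; rewrite memv_ker lfunE memv0 /= => /eqP Lf.
have ext_f0 : ext0 f = 0.
  apply: harmonic_eq0 => x xB; first by rewrite ffunE insubN.
  by have /ffunP/(_ (Sub x xB)) := Lf; rewrite !ffunE.
apply/eqP/ffunP => x; have /ffunP/(_ (val x)) := ext_f0.
by rewrite !ffunE valK.
Qed.

Lemma N0P (u : {ffun Omega B -> R^o}) : is_neumann_ext e u (N0 e u).
Proof.
apply: (@xgetPex {ffun V -> R^o}).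
pose c := restr (fun x => x \in B) (laplacian e (ext0 u)).
pose f := (linfun (@L_B R V e B))^-1%VF (- c).
have Lf : L_B e f = - c by rewrite -[LHS]lfunE lker0_lfunVK ?lker_L_B.
exists (ext0 u + ext0 f); split => [x|x xB].
  by rewrite !ffunE valK insubN ?addr0 // (valP x).
rewrite linearD ffunE; have /ffunP/(_ (Sub x xB)) := Lf.
by rewrite !ffunE /= => ->; rewrite subrr.
Qed.

Lemma is_neumann_ext_unique (u : {ffun Omega B -> R^o}) v v' :
  is_neumann_ext e u v -> is_neumann_ext e u v' -> v = v'.
Proof.
move=> [vu v0] [v'u v'0]; apply/eqP; rewrite -subr_eq0; apply/eqP.
apply: harmonic_eq0 => x xB; last first.
  by move: (v0 x xB) (v'0 x xB); rewrite linearB !ffunE => -> ->; rewrite subrr.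
by have := vu (Sub x xB); rewrite -v'u !ffunE => ->; rewrite subrr.
Qed.

Lemma N0_linear : linear (@N0 R V e B).
Proof.
move=> a u v; apply: (is_neumann_ext_unique (N0P _)).
have [Nu Lu] := N0P u; have [Nv Lv] := N0P v.
split=> x; first by rewrite !ffunE Nu Nv.
move=> xB; move: (Lu x xB) (Lv x xB); rewrite linearP !ffunE => -> ->.
by rewrite scaler0 addr0.
Qed.

Lemma neumann_laplacian_linear : linear (@neumann_laplacian R V e B).
Proof. by move=> a u v; rewrite /neumann_laplacian N0_linear !linearP. Qed.

Lemma NeumannE (u : {ffun Omega B -> R^o}) :
  Neumann R e B u = neumann_laplacian e u.
Proof.
pose NL := GRing.isLinear.Build R _ _ *:%R _ neumann_laplacian_linear.
pose T : {linear {ffun Omega B -> R^o} -> {ffun Omega B -> R^o}} :=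
  HB.pack (@neumann_laplacian R V e B) NL.
exact: (lfunE T).
Qed.

End Neumann.

(* Main.v *)
Require Import Defs.
From HB Require Import structures.
From mathcomp Require Import all_boot all_order all_algebra.
From mathcomp Require Import reals trigo.
From mathcomp Require complex.
From mathcomp Require Import ring lra zify.

Set Implicit Arguments.
Unset Strict Implicit.
Unset Printing Implicit Defensive.

Import Order.TTheory GRing.Theory Num.Theory.
Local Open Scope ring_scope.

(* A form bound [c |u|^2 + <Q u, u> <= <T u, u>] on a subspace of codimension
   at most 1 gives [c + lambda_(i-1)(Q) <= lambda_i(T)] by the min-max
   principle.  All four parts are of this kind (with Q = 0 in the first), with
   the functional [sum u] on Omega or [sum (N0 u)] on V: the form of the Neumann
   operator at u is the Dirichlet energy of N0 u, Dirichlet = Neumann + ALA, and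
   Dirichlet = laplacian of the induced graph + DegI.

   The constant c is Fiedler's bound 2 e(G) (1 - cos (pi / n)).  Sorting the
   vertices by the values of f, an edge between positions i < j pays at least
   the squared increments at the cuts k with i <= k < j, and each cut is crossed
   by at least e(G) edges.  This leaves the path on n vertices: summation by
   parts turns mean zero functions into functions S with S 0 = S n = 0, for
   which the positive ground state sin (k pi / n) gives the spectral gap. *)

(** * Spectral theorem and min-max principle *)

Section SymmetricMatrix.
Import complex.

(** Over the complex numbers [A] is hermitian, hence diagonalizable with real spectrum. [P] is
    invertible but not claimed orthogonal: orthogonality of eigenspaces comes later from
    self-adjointness. *)
Lemma symmetric_diagonalizable (R : rcfType) (n : nat) (A : 'M[R]_n) :
  A^T = A ->
  exists P (d : 'rV[R]_n), P \in unitmx /\ P *m A = diag_mx d *m P.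
Proof.
move=> symA.
pose toC : {rmorphism R -> R[i]} := real_complex R.
have real_toC m p (M : 'M[R]_(m, p)) : map_mx toC M \is a mxOver Num.real.
  by apply/mxOverP => j k; rewrite mxE; apply/complex_realP; exists (M j k).
have toC_Re m p (M : 'M[R[i]]_(m, p)) : M \is a mxOver Num.real ->
    map_mx toC (map_mx (@Re R) M) = M.
  by move=> /mxOverP Mr; apply/matrixP => j k; rewrite !mxE; apply: RRe_real.
have herm : map_mx toC A \is hermsymmx.
  apply: realsym_hermsym; last exact: real_toC.
  apply/is_hermitianmxP; rewrite expr0 scale1r map_mx_id // -[in LHS]symA.
  by rewrite map_trmx.
have Dreal := @hermitian_spectral_diag_real _ _ _ herm.
have /hermitian_normalmx/orthomx_spectralP AE := herm.
set D := spectral_diag _ in AE Dreal; set Q := spectralmx _ in AE.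
have Qu : Q \in unitmx by exact: spectral_unit.
have sim : similar Q (map_mx toC A) (diag_mx D).
  by apply/(similarP Qu); rewrite AE !mulmxA mulmxV // mul1mx.
have DE : diag_mx D = map_mx toC (diag_mx (map_mx (@Re R) D)).
  by rewrite map_diag_mx toC_Re.
(* Two real matrices similar over the complex numbers are similar through a real matrix, which
   brings the change of basis back to [R]. *)
have [||P] := @real_similar _ _ (map_mx toC A) (diag_mx D) _ (real_toC _ _ A).
- by exists Q.
- by rewrite DE real_toC.
rewrite inE => /andP[Preal Pu] /(similarP Pu) PA.
exists (map_mx (@Re R) P), (map_mx (@Re R) D).
rewrite -(map_unitmx toC) toC_Re //; split => //.
by apply: (map_mx_inj (f := toC)); rewrite !map_mxM /= toC_Re // -DE.
Qed.

End SymmetricMatrix.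

(** * Inner product on functions and self-adjoint operators *)

Definition dot (R : realType) (I : finType) (u v : {ffun I -> R^o}) : R :=
  \sum_x u x * v x.

Definition selfadjoint (R : realType) (I : finType)
    (T : 'End({ffun I -> R^o})) : Prop :=
  forall u v, dot (T u) v = dot u (T v).

Section Dot.
Variables (R : realType) (I : finType).
Implicit Types (u v w : {ffun I -> R^o}) (a : R).

Lemma dotC u v : dot u v = dot v u.
Proof. by apply: eq_bigr => x _; rewrite mulrC. Qed.

Lemma dotDl u v w : dot (u + v) w = dot u w + dot v w.
Proof. by rewrite -big_split; apply: eq_bigr => x _; rewrite !ffunE mulrDl. Qed.

Lemma dotDr u v w : dot w (u + v) = dot w u + dot w v.
Proof. by rewrite ![dot w _]dotC dotDl. Qed.

Lemma dotZl a u v : dot (a *: u) v = a * dot u v.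
Proof. by rewrite mulr_sumr; apply: eq_bigr => x _; rewrite !ffunE mulrA. Qed.

Lemma dotZr a u v : dot u (a *: v) = a * dot u v.
Proof. by rewrite dotC dotZl dotC. Qed.

Lemma dotBl u v w : dot (u - v) w = dot u w - dot v w.
Proof. by rewrite dotDl -scaleN1r dotZl mulN1r. Qed.

Lemma dotBr u v w : dot w (u - v) = dot w u - dot w v.
Proof. by rewrite ![dot w _]dotC dotBl. Qed.

Lemma dot0l u : dot 0 u = 0.
Proof. by rewrite /dot big1 // => x _; rewrite ffunE mul0r. Qed.

Lemma dot_ge0 u : 0 <= dot u u.
Proof. by apply: sumr_ge0 => x _; rewrite -expr2 sqr_ge0. Qed.

Lemma dot_eq0 u : dot u u = 0 -> u = 0.
Proof.
move=> /psumr_eq0P u0; apply/ffunP => x; rewrite ffunE; apply/eqP.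
by rewrite -sqrf_eq0 expr2 u0 // => y _; rewrite -expr2 sqr_ge0.
Qed.

Lemma dot_delta u (x : I) : dot u [ffun y => (y == x)%:R] = u x.
Proof.
rewrite /dot (bigD1 x) //= ffunE eqxx mulr1 big1 ?addr0 // => y /negPf yx.
by rewrite ffunE yx mulr0.
Qed.

End Dot.

Import passmx.

Section SpectralTheorem.
Variables (R : realType) (I : finType) (T : 'End({ffun I -> R^o})).
Hypothesis symT : selfadjoint T.
Local Notation X := {ffun I -> R^o}.

(** The rows of the diagonalizing matrix, read as functions through the enumeration of [I], are
    eigenvectors; they span because that matrix is invertible. *)
Lemma selfadjoint_eigenvectors :
  exists (q : 'I_#|I| -> X) (d : 'I_#|I| -> R),
    (forall k, T (q k) = d k *: q k) /\
    forall u, exists c : 'I_#|I| -> R, u = \sum_k c k *: q k.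
Proof.
pose vec (v : 'rV[R]_#|I|) : X := [ffun x => v 0 (enum_rank x)].
pose unvec (u : X) : 'rV[R]_#|I| := \row_k u (enum_val k).
pose delta x : X := [ffun y => (y == x)%:R].
have unvecK u : vec (unvec u) = u.
  by apply/ffunP => x; rewrite ffunE mxE enum_rankK.
(* Row [j] holds the image of the [j]-th delta function, so [T] acts on row vectors by right
   multiplication. *)
pose A : 'M[R]_#|I| := \matrix_(j, k) T (delta (enum_val j)) (enum_val k).
have symA : A^T = A.
  by apply/matrixP => j k; rewrite !mxE -[LHS]dot_delta symT dotC dot_delta.
have vecE v : vec v = \sum_k v 0 k *: delta (enum_val k).
  apply/ffunP => x; rewrite ffunE sum_ffunE (bigD1 (enum_rank x)) //=.
  rewrite !ffunE enum_rankK eqxx /GRing.scale /= mulr1 big1 ?addr0 // => k kx.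
  rewrite !ffunE; case: eqP => [xk|_]; last by rewrite /GRing.scale /= mulr0.
  by rewrite xk enum_valK eqxx in kx.
have vecA v : T (vec v) = vec (v *m A).
  rewrite vecE linear_sum; apply/ffunP => x; rewrite sum_ffunE !ffunE mxE.
  by apply: eq_bigr => k _; rewrite linearZ /= ffunE mxE enum_rankK.
have vecZ a v : vec (a *: v) = a *: vec v by apply/ffunP => x; rewrite !(ffunE, mxE).
have [P [d [Pu PA]]] := symmetric_diagonalizable symA.
exists (fun k => vec (row k P)), (fun k => d 0 k); split=> [k|u].
  by rewrite vecA -row_mul PA row_mul row_diag_mx -scalemxAl -rowE vecZ.
exists (fun k => (unvec u *m invmx P) 0 k).
have vecP w : vec (w *m P) = \sum_k w 0 k *: vec (row k P).
  rewrite mulmx_sum_row; apply/ffunP => x; rewrite ffunE summxE sum_ffunE.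
  by apply: eq_bigr => k _; rewrite !ffunE !mxE.
by rewrite -vecP mulmxKV // unvecK.
Qed.

Lemma eigenP (a : R) (u : X) : reflect (T u = a *: u) (u \in leigenspace T a).
Proof.
rewrite memv_ker add_lfunE opp_lfunE scale_lfunE id_lfunE subr_eq0.
exact: eqP.
Qed.

Lemma eigen_orthogonal (a b : R) (u v : X) :
  u \in leigenspace T a -> v \in leigenspace T b -> a != b -> dot u v = 0.
Proof.
move=> /eigenP Tu /eigenP Tv ab; apply/eqP; have := symT u v.
rewrite Tu Tv dotZl dotZr => /eqP.
by rewrite -subr_eq0 -mulrBl mulf_eq0 subr_eq0 (negPf ab).
Qed.

Local Notation eigensum r := (\sum_(a <- r) leigenspace T a)%VS.

Lemma eigensum_orthogonal (a : R) (r : seq R) (u v : X) :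
  a \notin r -> u \in leigenspace T a -> v \in eigensum r -> dot u v = 0.
Proof.
elim: r v => [|b r IHr] v; first by rewrite big_nil memv0 dotC => _ _ /eqP->; rewrite dot0l.
rewrite inE negb_or big_cons => /andP[ab ar] ua /memv_addP[w wb [t tr ->]].
by rewrite dotDr (eigen_orthogonal ua wb ab) IHr // addr0.
Qed.

Lemma eigensum_stable (r : seq R) (u : X) : u \in eigensum r -> T u \in eigensum r.
Proof.
elim: r u => [|b r IHr] u; first by rewrite big_nil memv0 => /eqP->; rewrite linear0 mem0v.
rewrite big_cons => /memv_addP[w wb [t tr ->]]; rewrite linearD /= memv_add ?IHr //.
by have /eigenP-> := wb; rewrite memvZ.
Qed.

(** A vector common to an eigenspace and the sum of the others is orthogonal to itself, so the sum
    is direct. *)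
Lemma dim_eigensum (r : seq R) :
  uniq r -> \dim (eigensum r) = (\sum_(a <- r) \dim (leigenspace T a))%N.
Proof.
elim: r => [|a r IHr] /=; first by rewrite !big_nil dimv0.
case/andP=> ar ur; rewrite !big_cons dimv_disjoint_sum ?IHr //.
apply/eqP; rewrite -subv0; apply/subvP => u; rewrite memv_cap memv0 => /andP[ua uar].
exact/eqP/dot_eq0/(eigensum_orthogonal ar ua uar).
Qed.

(** The sign [sg] covers both estimates: 1 bounds the form below, -1 bounds it above. Cross terms
    vanish by orthogonality and stability of the eigenspaces. *)
Lemma eigensum_form (sg c : R) (r : seq R) (u : X) :
  uniq r -> {in r, forall a, 0 <= sg * (a - c)} -> u \in eigensum r ->
  0 <= sg * (dot (T u) u - c * dot u u).
Proof.
elim: r u => [|a r IHr] u /=.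
  by rewrite big_nil memv0 => _ _ /eqP->; rewrite linear0 dot0l mulr0 subrr mulr0.
case/andP=> ar ur pr; rewrite big_cons => /memv_addP[w wa [v vr ->]].
have wv : dot w v = 0 by exact: eigensum_orthogonal ar wa vr.
have wTv : dot w (T v) = 0 by exact: eigensum_orthogonal ar wa (eigensum_stable vr).
have /eigenP Tw := wa.
rewrite linearD /= !(dotDl, dotDr) [dot v w]dotC [dot (T v) w]dotC wv wTv Tw !dotZl.
rewrite wv mulr0 !addr0 !add0r.
have := IHr v ur (fun b br => pr b (mem_behead (s := a :: r) br)) vr.
have := mulr_ge0 (pr a (mem_head _ _)) (dot_ge0 w).
move: (dot (T v) v) (dot v v) (dot w w) => x y z; nra.
Qed.

Let s := spectrum T.

Let count_spectrum a : count_mem a s = \dim (leigenspace T a).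
Proof. by have [_ ->] := spectrumP T. Qed.

(** Multiplicities in the spectrum are dimensions of eigenspaces; this turns positions in the sorted
    spectrum into dimensions of subspaces. *)
Lemma dim_eigensum_filter (p : pred R) :
  \dim (eigensum (filter p (undup s))) = count p s.
Proof.
rewrite dim_eigensum ?filter_uniq ?undup_uniq //.
rewrite (eq_bigr (fun a => count_mem a s)) => [|a _]; last by rewrite count_spectrum.
rewrite big_filter.
have := perm_count_undup s => /permP/(_ p) <-.
rewrite count_flatten sumnE !big_map [in LHS]big_mkcond /=; apply: eq_bigr => a _.
by rewrite count_nseq; case: (p a); rewrite ?mul1n ?mul0n.
Qed.

Lemma eigensum_spectrum : eigensum (undup s) = fullv.
Proof.
have [q [d [Tq qP]]] := selfadjoint_eigenvectors.
apply/eqP; rewrite eqEsubv subvf /=; apply/subvP => u _.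
have [c ->] := qP u; apply: memv_suml => k _; apply: memvZ.
have [->|qk0] := eqVneq (q k) 0; first exact: mem0v.
have qd : q k \in leigenspace T (d k) by apply/eigenP; rewrite Tq.
(* A nonzero eigenvector gives its eigenvalue a positive multiplicity, so the value is listed in
   [s]. *)
have ds : d k \in undup s.
  rewrite mem_undup -has_pred1 has_count count_spectrum lt0n dimv_eq0.
  by apply: contraNneq qk0 => E0; rewrite E0 memv0 in qd.
by rewrite (bigD1_seq (d k)) ?undup_uniq //=; apply: subvP (addvSl _ _) _ qd.
Qed.

Lemma size_spectrum : size s = #|I|.
Proof.
have := dim_eigensum_filter predT.
by rewrite filter_predT eigensum_spectrum count_predT dimvf => <-; rewrite /dim /= muln1.
Qed.

End SpectralTheorem.

(** * Dimension counts and the Courant-Fischer bounds *)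

Lemma count_lt_sorted (R : realType) (s : seq R) (j : nat) :
  sorted <=%R s -> (count (< nth 0%R s j)%R s <= j)%N.
Proof.
move=> ss; rewrite leqNgt; apply/negP => js.
by have := nth_count_lt 0 ss js; rewrite ltxx.
Qed.

Lemma count_le_sorted (R : realType) (s : seq R) (j : nat) :
  sorted <=%R s -> (j < size s)%N -> (j < count (<= nth 0%R s j)%R s)%N.
Proof.
move=> ss js; rewrite ltnNge; apply/negP => sj.
have jsj : (count (<= nth 0%R s j)%R s <= j < size s)%N by rewrite sj.
by have := nth_count_gt 0 ss jsj; rewrite ltxx.
Qed.

Lemma dimv_cap_ge (F : fieldType) (vT : vectType F) (U W : {vspace vT}) (m : nat) :
  (\dim {:vT} + m <= \dim U + \dim W)%N -> (m <= \dim (U :&: W))%N.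
Proof.
rewrite -dimv_sum_cap => UW; have := dimvS (subvf (U + W)%VS).
lia.
Qed.

Section CourantFischer.
Variables (R : realType) (I : finType).
Local Notation X := {ffun I -> R^o}.
Implicit Types (T Q : 'End(X)) (U : {vspace X}).

Lemma dim_ffun : \dim {: X}%VS = #|I|.
Proof. by rewrite dimvf /dim /= muln1. Qed.

(** The witness is the sum of the eigenspaces for eigenvalues at least the [j]-th; at most [j - 1]
    entries of the spectrum are missed. *)
Lemma eigval_form_subspace T (j : nat) : selfadjoint T -> (1 <= j <= #|I|)%N ->
  exists U, (#|I| < \dim U + j)%N /\
    {in U, forall u, eigval T j * dot u u <= dot (T u) u}.
Proof.
move=> symT /andP[j1 jI]; have [ss _] := spectrumP T.
exists (\sum_(a <- filter (predC (< eigval T j)) (undup (spectrum T))) leigenspace T a)%VS.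
split=> [|u uU].
  rewrite dim_eigensum_filter // -(size_spectrum symT).
  rewrite -(count_predC (< eigval T j)) addnC ltn_add2l -(prednK j1) ltnS.
  exact: count_lt_sorted.
rewrite -subr_ge0 -[leRHS]mul1r; apply: (eigensum_form symT _ _ uU).
  by rewrite filter_uniq ?undup_uniq.
by move=> a; rewrite mem_filter mul1r subr_ge0 /= -leNgt => /andP[].
Qed.

(** The eigenspaces for eigenvalues at most the [i]-th span dimension at least [i], so their sum
    meets [U] in a nonzero vector, where the two bounds on the form are compared. *)
Lemma eigval_ge_subspace T (i : nat) (c : R) U :
  selfadjoint T -> (1 <= i <= #|I|)%N -> (#|I| < \dim U + i)%N ->
  {in U, forall u, c * dot u u <= dot (T u) u} -> c <= eigval T i.
Proof.
move=> symT /andP[i1 iI] dimU formU; have [ss _] := spectrumP T.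
set W := (\sum_(a <- filter (<= eigval T i) (undup (spectrum T))) leigenspace T a)%VS.
have dimW : (i <= \dim W)%N.
  rewrite dim_eigensum_filter // -{1}(prednK i1) count_le_sorted //.
  by rewrite size_spectrum // prednK.
have dimUW : (0 < \dim (U :&: W))%N.
  apply: dimv_cap_ge; rewrite dim_ffun addn1; apply: leq_trans dimU _.
  by rewrite leq_add2l.
have UW0 : vpick (U :&: W) != 0 by rewrite vpick0 -dimv_eq0 -lt0n.
have := memv_pick (U :&: W); rewrite memv_cap.
set u := vpick _ in UW0 * => /andP[uU uW].
have u_gt0 : 0 < dot u u.
  by rewrite lt_neqAle dot_ge0 andbT eq_sym; apply: contraNneq UW0 => /dot_eq0->.
have := eigensum_form (sg := -1) (c := eigval T i) symT _ _ uW.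
rewrite filter_uniq ?undup_uniq // => /(_ isT) uform.
have {uform} uform : dot (T u) u <= eigval T i * dot u u.
  rewrite -subr_ge0 -opprB -mulN1r; apply: uform => a.
  by rewrite mem_filter mulN1r opprB subr_ge0 => /andP[].
by rewrite -(ler_pM2r u_gt0); apply: le_trans (formU u uU) uform.
Qed.

Lemma dim_lker (vT : vectType R) (g : 'Hom(X, vT)) :
  (#|I| <= \dim (lker g) + \dim {:vT})%N.
Proof.
rewrite -dim_ffun -(limg_ker_dim g fullv) capfv leq_add2l.
exact: dimvS (subvf _).
Qed.

Lemma dim_lker_functional (g : 'Hom(X, R^o)) : (#|I| < \dim (lker g) + 2)%N.
Proof. by have := dim_lker g; rewrite dimvf /dim /= addn1 addn2. Qed.

(** The subspace attached to the eigenvalue [i.-1] of [Q] has dimension at least [#|I| - i + 2].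
    Cutting it by one functional costs at most one dimension and leaves what the bound on the
    eigenvalue [i] of [T] requires. *)
Lemma eigval_ge_perturb T Q (i : nat) (c : R) (g : 'Hom(X, R^o)) :
  selfadjoint T -> selfadjoint Q -> (2 <= i <= #|I|)%N ->
  {in lker g, forall u, c * dot u u + dot (Q u) u <= dot (T u) u} ->
  c + eigval Q i.-1 <= eigval T i.
Proof.
move=> symT symQ iI form.
have [|U [dimU formU]] := eigval_form_subspace (j := i.-1) symQ; first lia.
apply: (eigval_ge_subspace (U := (U :&: lker g)%VS)) => // [|| u].
- lia.
- suff : (#|I| - i < \dim (U :&: lker g))%N by lia.
  apply: dimv_cap_ge; rewrite dim_ffun.
  apply: (@leq_trans (#|I|.+1 + #|I|.+1 - i.+1)); first by clear -iI; lia.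
  rewrite leq_subLR; apply: leq_trans (leq_add dimU (dim_lker_functional g)) _.
  by rewrite addnACA addn2 prednK 1?addnC //; clear -iI; lia.
rewrite memv_cap => /andP[uU ug]; apply: le_trans (form u ug).
by rewrite mulrDl lerD2l formU.
Qed.

End CourantFischer.

(** * The spectral gap of the path *)

(** The discrete eigenvalue equation of the path, satisfied by its ground state. *)
Lemma sin_recurrence (R : realType) (t : R) (k : nat) :
  sin (k.+2%:R * t) + sin (k%:R * t) = 2 * cos t * sin (k.+1%:R * t).
Proof.
have -> : k.+2%:R * t = k.+1%:R * t + t by rewrite -addn1 natrD mulrDl mul1r.
have -> : k%:R * t = k.+1%:R * t - t by rewrite -(addn1 k) natrD mulrDl mul1r addrK.
by rewrite sinB sinD; ring.
Qed.

(** A discrete Riccati argument: the ratios of consecutive values of the ground state [phi] control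
    the partial deficits [A], and the control becomes nonnegativity at the right end, where [S] and
    [phi] both vanish. *)
Lemma path_dirichlet (R : realType) (S : nat -> R) (n : nat) :
  S 0 = 0 -> S n = 0 ->
  2 * (1 - cos (pi / n%:R)) * (\sum_(k < n) S k ^+ 2)
    <= \sum_(k < n) (S k.+1 - S k) ^+ 2.
Proof.
case: n => [|[|n]] S0 Sn.
- by rewrite !big_ord0 mulr0.
- by rewrite !big_ord1 S0 Sn; lra.
set t := pi / _; pose phi (k : nat) : R := sin (k%:R * t).
have phi_gt0 k : (0 < k < n.+2)%N -> 0 < phi k.
  move=> /andP[k0 kn]; apply: sin_gt0_pi; apply/andP; split.
    by rewrite mulr_gt0 ?ltr0n // divr_gt0 ?pi_gt0 ?ltr0n.
  by rewrite /t mulrCA gtr_pMr ?pi_gt0 // ltr_pdivrMr ?ltr0n // mul1r ltr_nat.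
have phi0 : phi 0 = 0 by rewrite /phi mul0r sin0.
have phin : phi n.+2 = 0 by rewrite /phi /t mulrCA mulfV ?pnatr_eq0 // mulr1 sinpi.
pose A (j : nat) := \sum_(k < j) (S k.+1 - S k) ^+ 2
  - 2 * (1 - cos t) * \sum_(k < j) S k ^+ 2.
have AS j : A j.+1 = A j + (S j.+1 - S j) ^+ 2 - 2 * (1 - cos t) * S j ^+ 2.
  by rewrite /A !big_ord_recr /=; ring.
have phi_ratio k : (k.+1 < n.+2)%N ->
    phi k.+2 / phi k.+1 = 2 * cos t - phi k / phi k.+1.
  move=> kn; apply/eqP; rewrite eq_sym subr_eq -mulrDl sin_recurrence mulfK //.
  by rewrite gt_eqF // phi_gt0.
have Age k : (k.+1 < n.+2)%N -> S k.+1 ^+ 2 * (1 - phi k / phi k.+1) <= A k.+1.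
  elim: k => [_|k IHk kn].
    by rewrite phi0 mul0r AS S0 /A !big_ord0; lra.
  have := IHk (ltnW kn); have := phi_ratio k (ltnW kn); rewrite [A k.+2]AS.
  rewrite -[phi k.+1 / phi k.+2]invf_div.
  have p_gt0 : 0 < phi k.+2 / phi k.+1 by rewrite divr_gt0 ?phi_gt0 //= ltnW.
  move: (phi k.+2 / phi k.+1) (phi k / phi k.+1) p_gt0 => p q p_gt0 pE Ak.
  (* Completing the square: the lower bound obtained so far is a quadratic form in [S k.+1] and
     [S k.+2], and it exceeds the new bound by exactly this square. *)
  have := mulr_ge0 (ltW (_ : 0 < p^-1)) (sqr_ge0 (p * S k.+1 - S k.+2)).
  rewrite invr_gt0 => /(_ p_gt0).
  have -> : p^-1 * (p * S k.+1 - S k.+2) ^+ 2 =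
      p * S k.+1 ^+ 2 - 2 * S k.+1 * S k.+2 + p^-1 * S k.+2 ^+ 2.
    by field; rewrite gt_eqF.
  rewrite {}pE; move: Ak; rewrite /=; lra.
rewrite -subr_ge0 -/(A n.+2) AS Sn.
(* At the last step the recurrence, with [phi n.+2 = 0], makes the coefficient of [S n.+1 ^+ 2]
   zero. *)
have := Age n (ltnSn _); have := phi_ratio n (ltnSn _).
rewrite phin mul0r => /esym/eqP; rewrite subr_eq0 => /eqP <-; lra.
Qed.

(** Write F, D and Q for the sums of squares of [f], of its increments and of its partial sums [S].
    Summation by parts turns the square below into [D - 2 lam F + lam^2 Q >= 0], and
    [path_dirichlet] gives [lam Q <= F], whence [lam F <= D]. *)
Lemma path_poincare (R : realType) (f : nat -> R) (n : nat) :
  \sum_(k < n) f k = 0 ->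
  2 * (1 - cos (pi / n%:R)) * (\sum_(k < n) f k ^+ 2)
    <= \sum_(k < n.-1) (f k.+1 - f k) ^+ 2.
Proof.
case: n => [|n] f0; first by rewrite !big_ord0 mulr0.
set lam := 2 * (1 - _); pose S k : R := \sum_(j < k) f j.
have lam_ge0 : 0 <= lam by rewrite mulr_ge0 // subr_ge0 cos_le1.
have S0 : S 0 = 0 by rewrite /S big_ord0.
have fS k : S k.+1 - S k = f k by rewrite /S big_ord_recr /= addrAC subrr add0r.
have := path_dirichlet S0 f0; rewrite -/lam; under [X in _ <= X]eq_bigr do rewrite fS.
rewrite [X in lam * X]big_ord_recl S0 expr0n add0r /=.
have parts m : \sum_(k < m) S k.+1 * (f k.+1 - f k) =
    S m.+1 * f m - \sum_(k < m.+1) f k ^+ 2.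
  elim: m => [|m IHm]; first by rewrite big_ord0 big_ord1 /S big_ord1; ring.
  rewrite big_ord_recr IHm [X in _ = _ - X]big_ord_recr /= -(fS m.+1); ring.
have := parts n; rewrite [S n.+1]f0 mul0r sub0r.
have : 0 <= \sum_(k < n) (f k.+1 - f k + lam * S k.+1) ^+ 2.
  by apply: sumr_ge0 => k _; apply: sqr_ge0.
have -> : \sum_(k < n) (f k.+1 - f k + lam * S k.+1) ^+ 2 =
    \sum_(k < n) (f k.+1 - f k) ^+ 2
    + 2 * lam * (\sum_(k < n) S k.+1 * (f k.+1 - f k))
    + lam * (lam * \sum_(k < n) S k.+1 ^+ 2).
  by rewrite !mulr_sumr -!big_split; apply: eq_bigr => k _ /=; ring.
move=> sq_ge0 partsn dir; have := ler_wpM2l lam_ge0 dir; move: sq_ge0.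
rewrite partsn /bump /=; lra.
Qed.

(** * Fiedler's bound *)

(** Deleting all edges that leave [S] separates [a] from [b], so these edges compete in the
    minimum. *)
Lemma edge_connectivity_le_cut (V : finType) (e : rel V) (S : pred V) (a b : V) :
  S a -> ~~ S b ->
  (edge_connectivity e <= \sum_(x | S x) \sum_(y | ~~ S y) e x y)%N.
Proof.
move=> Sa Sb.
have /edge_connectivityP -/(_ e)[F [_ _ <- minF]] : (1 < #|V|)%N.
  by apply/card_gt1P; exists a, b; split=> //; apply: contraNneq Sb => <-.
pose cut := [set p : V * V | [&& S p.1, ~~ S p.2 & e p.1 p.2]].
pose C := [set [set p.1; p.2] | p in cut].
apply: (@leq_trans #|C|); last first.
  apply: leq_trans (leq_imset_card _ _) _.
  rewrite -sum1_card pair_big big_mkcond [leqRHS]big_mkcond /=.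
  by apply: leq_sum => -[x y] _; rewrite inE /=; case: (S x) (S y) (e x y) => [] [] [].
apply: minF.
  apply/subsetP => _ /imsetP[[x y] + ->]; rewrite !inE => /and3P[_ _ exy].
  by apply/existsP; exists x; apply/existsP; exists y; rewrite exy eqxx.
apply/negP => /forallP/(_ a)/forallP/(_ b)/connectP[p + bE].
(* After the deletion a path that starts in [S] never leaves [S], so it cannot end at [b]. *)
elim: p a Sa bE => [|y p IHp] x Sx /= bE; first by rewrite bE Sx in Sb.
case/andP=> /andP[exy xyC] /(IHp y _ bE); apply.
apply: contraNT xyC => Sy; apply/imsetP; exists (x, y) => //.
by rewrite inE /= Sx Sy.
Qed.

(* The sum is over ordered pairs, so every edge is counted twice. *)
Definition energy (R : realType) (V : finType) (e : rel V) (f : {ffun V -> R^o}) : R :=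
  \sum_x \sum_y (f x - f y) ^+ 2 * weight R e x y.

(** Over ordered pairs the cut is crossed in both directions: the bound is applied to [S] and to its
    complement. *)
Lemma edge_connectivity_le_cuts (R : realType) (V : finType) (e : rel V)
    (S : pred V) (a b : V) :
  S a -> ~~ S b ->
  2 * (edge_connectivity e)%:R <= \sum_x \sum_y (S x != S y)%:R * weight R e x y.
Proof.
move=> Sa Sb.
have le1 := edge_connectivity_le_cut e Sa Sb.
have le2 : (edge_connectivity e <= \sum_(x | ~~ S x) \sum_(y | S y) e x y)%N.
  have := @edge_connectivity_le_cut _ e (predC S) b a Sb; rewrite /= negbK => /(_ Sa).
  rewrite (eq_bigr (fun x => \sum_(y | S y) e x y)%N) // => x _.
  by apply: eq_bigl => y; rewrite negbK.
suff -> : \sum_x \sum_y (S x != S y)%:R * weight R e x y =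
    (\sum_(x | S x) \sum_(y | ~~ S y) e x y
     + \sum_(x | ~~ S x) \sum_(y | S y) e x y)%:R.
  by rewrite -natrM ler_nat mul2n -addnn leq_add.
rewrite natrD !natr_sum [in RHS]big_mkcond [X in _ + X]big_mkcond -big_split /=.
apply: eq_bigr => x _; case: (S x); rewrite ?addr0 ?add0r natr_sum [RHS]big_mkcond /=;
  by apply: eq_bigr => y _; case: (S y); rewrite /weight ?mul1r ?mul0r.
Qed.

(** For nonnegative increments the sum of the squares is at most the square of the sum. *)
Lemma monotone_increments (R : realType) (g : nat -> R) (n i j : nat) :
  (forall k l, (k <= l < n)%N -> g k <= g l) -> (i <= j < n)%N ->
  \sum_(k < n.-1 | (i <= k < j)%N) (g k.+1 - g k) ^+ 2 <= (g j - g i) ^+ 2.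
Proof.
move=> gmono; elim: j => [|j IHj] /andP[ij jn].
  by rewrite big_pred0 ?sqr_ge0 // => k; rewrite ltn0 andbF.
have [->|ij'] := eqVneq i j.+1.
  by rewrite big_pred0 ?sqr_ge0 // => k; lia.
have {}ij : (i <= j)%N by lia.
have jn1 : (j < n.-1)%N by lia.
rewrite (bigD1 (Ordinal jn1)) /=; last by rewrite ij ltnSn.
have := IHj _; rewrite ij (ltnW jn) => /(_ isT).
rewrite (eq_bigl (fun k : 'I_n.-1 => (i <= k < j)%N)); last first.
  by move=> k; rewrite -val_eqE /=; lia.
have := gmono j j.+1; rewrite leqnSn jn => /(_ isT).
have := gmono i j; rewrite ij (ltnW jn) => /(_ isT).
move: (g j.+1) (g j) (g i) => x y z zy yx le1.
(* Half of the cross term in the expansion of [(x - z) ^+ 2] around [y]. *)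
have : 0 <= (x - y) * (y - z) by rewrite mulr_ge0 ?subr_ge0.
nra.
Qed.

(** The outer factor 2 matches [energy], which counts each edge twice. *)
Lemma fiedler (R : realType) (V : finType) (e : rel V) (f : {ffun V -> R^o}) :
  \sum_x f x = 0 ->
  2 * (2 * (edge_connectivity e)%:R * (1 - cos (pi / #|V|%:R)) * dot f f)
    <= energy e f.
Proof.
move=> f0; have [x0 _|V0] := pickP V; last first.
  rewrite /dot /energy !big_pred0 ?mulr0 // => x; have := V0 x; by [].
pose s := sort (fun x y => f x <= f y) (enum V).
have size_s : size s = #|V| by rewrite size_sort cardE.
have uniq_s : uniq s by rewrite sort_uniq enum_uniq.
have mem_s x : x \in s by rewrite mem_sort mem_enum.
(* [g] is [f] listed in increasing order, and [r x] is the position of [x] in that order. *)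
pose g k : R := f (nth x0 s k); pose r x := index x s.
have rP x : (r x < #|V|)%N by rewrite -size_s index_mem.
have gr x : f x = g (r x) by rewrite /g nth_index.
have sumE (F : V -> R) : \sum_x F x = \sum_(k < #|V|) F (nth x0 s k).
  have /(perm_big _)/= <- : perm_eq s (index_enum V).
    by apply: uniq_perm; rewrite ?index_enum_uniq // => x; rewrite mem_s mem_index_enum.
  by rewrite (big_nth x0) big_mkord size_s.
have gmono k l : (k <= l < #|V|)%N -> g k <= g l.
  move=> /andP[kl ln].
  have sorted_s : sorted (fun x y => f x <= f y) s.
    by apply: sort_sorted => x y; apply: le_total.
  apply: (sorted_leq_nth _ _ x0 sorted_s) => //.
  - by move=> y x z; apply: le_trans.
  - by rewrite inE size_s; lia.
  - by rewrite inE size_s; lia.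
set D := \sum_(k < #|V|.-1) (g k.+1 - g k) ^+ 2.
have poincare : 2 * (1 - cos (pi / #|V|%:R)) * dot f f <= D.
  rewrite /dot sumE; under [X in _ * X]eq_bigr do rewrite -expr2.
  by apply: path_poincare; rewrite -(sumE (fun x => f x)).
(* The indicator selects the cuts [k] that separate the positions of [x] and [y]. *)
have edge x y : \sum_(k < #|V|.-1) (g k.+1 - g k) ^+ 2
    * ((r x <= k)%N != (r y <= k)%N)%:R <= (f x - f y) ^+ 2.
  wlog rxy : x y / (r x <= r y)%N.
    move=> wl; have [/wl//|/ltnW/wl] := leqP (r x) (r y).
    rewrite -sqrrN opprB; under eq_bigr do rewrite eq_sym.
    exact.
  rewrite -sqrrN opprB !gr; apply: le_trans (monotone_increments gmono _); last first.
    by rewrite rxy rP.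
  rewrite [leRHS]big_mkcond /=; apply: ler_sum => k _.
  case: ifP => kxy.
    by rewrite ler_piMr ?sqr_ge0 // lern1; case: (_ != _).
  suff -> : (r x <= k)%N == (r y <= k)%N by rewrite mulr0.
  by apply/eqP; lia.
(* The set is the first [k + 1] vertices; those at positions [k] and [k + 1] show that both sides
   are nonempty. *)
have cuts k : (k < #|V|.-1)%N -> 2 * (edge_connectivity e)%:R <=
    \sum_x \sum_y ((r x <= k)%N != (r y <= k)%N)%:R * weight R e x y.
  move=> kn; apply: (@edge_connectivity_le_cuts _ _ _ (fun x => (r x <= k)%N)
    (nth x0 s k) (nth x0 s k.+1)).
    by rewrite /r index_uniq // size_s; lia.
  by rewrite /r index_uniq ?size_s ?ltnn //; lia.
apply: (@le_trans _ _ (2 * (edge_connectivity e)%:R * D)).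
  have := ler_wpM2l (_ : 0 <= 2 * (edge_connectivity e)%:R) poincare.
  by rewrite mulr_ge0 ?ler0n // => /(_ isT); lra.
apply: (@le_trans _ _ (\sum_x \sum_y (\sum_(k < #|V|.-1) (g k.+1 - g k) ^+ 2
    * ((r x <= k)%N != (r y <= k)%N)%:R) * weight R e x y)); last first.
  by apply: ler_sum => x _; apply: ler_sum => y _; rewrite ler_wpM2r ?ler0n.
(* The sum over cuts is moved outside, so that each squared increment is multiplied by the weight of
   its cut. *)
under [leRHS]eq_bigr do under eq_bigr do rewrite mulr_suml.
under [leRHS]eq_bigr do rewrite exchange_big.
rewrite exchange_big /= mulr_sumr; apply: ler_sum => k _.
under eq_bigr do under eq_bigr do rewrite -mulrA.
under eq_bigr do rewrite -mulr_sumr.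
rewrite -mulr_sumr mulrC ler_wpM2l ?sqr_ge0 //; exact: cuts.
Qed.

(** * The Dirichlet and Neumann forms *)

(** Packages maps whose linearity is proved only under hypotheses, such as the mean of [N0 e u], so
    that their kernels are available. *)
Lemma linear_lfun (R : realType) (aT rT : vectType R) (f : aT -> rT) :
  linear f -> exists g : 'Hom(aT, rT), g =1 f.
Proof.
move=> lin_f; pose h : {linear aT -> rT} :=
  HB.pack f (GRing.isLinear.Build R _ _ *:%R f lin_f).
by exists (linfun h) => u; rewrite lfunE.
Qed.

Lemma sum_sub (R : realType) (V : finType) (P : pred V) (F : V -> R) :
  \sum_(x : {x : V | P x}) F (val x) = \sum_(x | P x) F x.
Proof.
rewrite (reindex_omap (val : {x : V | P x} -> V) insub) /=.
  by apply: eq_bigl => x; rewrite valK eqxx (valP x).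
by move=> x Px; rewrite insubT.
Qed.

Section Forms.
Variables (R : realType) (V : finType).
Implicit Types (e : rel V) (u v : {ffun V -> R^o}) (P : pred V).

(** Green's identity: one of two copies of the left side has [x] and [y] exchanged. *)
Lemma green e u v : symmetric e ->
  2 * dot (laplacian e u) v
    = \sum_x \sum_y (u x - u y) * (v x - v y) * weight R e x y.
Proof.
move=> sym_e; have wC x y : weight R e x y = weight R e y x by rewrite /weight sym_e.
have dotE : dot (laplacian e u) v = \sum_x \sum_y (u x - u y) * v x * weight R e x y.
  rewrite /dot; apply: eq_bigr => x _; rewrite ffunE mulr_suml.
  by apply: eq_bigr => y _; rewrite mulrAC.
rewrite mulr2n mulrDl !mul1r {2}dotE exchange_big /= dotE -big_split /=.
apply: eq_bigr => x _; rewrite -big_split; apply: eq_bigr => y _ /=.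
by rewrite [weight R e y x]wC; ring.
Qed.

Lemma laplacian_selfadjoint e u v : symmetric e ->
  dot (laplacian e u) v = dot u (laplacian e v).
Proof.
move=> sym_e; apply: (@mulfI _ 2); first by rewrite pnatr_eq0.
rewrite [dot u _]dotC !green //.
by apply: eq_bigr => x _; apply: eq_bigr => y _; rewrite [X in X * _]mulrC.
Qed.

Lemma fiedler_laplacian e u : symmetric e -> \sum_x u x = 0 ->
  2 * (edge_connectivity e)%:R * (1 - cos (pi / #|V|%:R)) * dot u u
    <= dot (laplacian e u) u.
Proof.
move=> sym_e /(fiedler e) energy_ge.
have green_u : 2 * dot (laplacian e u) u = energy e u by rewrite green.
lra.
Qed.

(** Identifies the Laplacian of a zero extension with [- A_Omega] on [B] and with [- A_B] on the
    interior. *)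
Lemma laplacian_ext0_out e P (f : {ffun {x : V | P x} -> R^o}) (x : V) :
  ~~ P x ->
  laplacian e (ext0 f) x = - \sum_(y : {y : V | P y}) f y * weight R e x (val y).
Proof.
move=> Px; rewrite ffunE [ext0 f x]ffunE insubN //=.
rewrite (bigID P) /= addrC big1 => [|y Py]; last first.
  by rewrite ffunE insubN //= subrr mul0r.
rewrite add0r -sum_sub -sumrN; apply: eq_bigr => y _.
by rewrite ffunE valK /= sub0r mulNr.
Qed.

(** Moves a form from a vertex subset to [V]. Outside the subset the product vanishes through [v] in
    the Dirichlet case and through the Laplacian [g] in the Neumann case. *)
Lemma dot_restr P (g v : {ffun V -> R^o}) (u : {ffun {x : V | P x} -> R^o}) :
  (forall x, v (val x) = u x) -> (forall x, ~~ P x -> g x * v x = 0) ->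
  dot (restr P g) u = dot g v.
Proof.
move=> vu gv0; rewrite /dot [RHS](bigID P) /= [X in _ + X]big1 ?addr0 //.
rewrite -[RHS](sum_sub P (fun x => g x * v x)).
by apply: eq_bigr => x _; rewrite ffunE vu.
Qed.

Lemma edge_constant_ge0 e :
  0 <= 2 * (edge_connectivity e)%:R * (1 - cos (pi / #|V|%:R)) :> R.
Proof. by rewrite !mulr_ge0 ?ler0n // subr_ge0 cos_le1. Qed.

End Forms.

(** * Quadratic forms of the operators on the interior *)

Section Operators.
Variables (R : realType) (V : finType) (e : rel V) (B : {set V}).
Hypotheses (sym_e : symmetric e) (conn_e : connected_graph e).
Hypothesis Omega_gt0 : (0 < #|Omega B|)%N.
Local Notation X := {ffun Omega B -> R^o}.
Implicit Types (u v : X).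

Lemma Dirichlet_dot u v :
  dot (Dirichlet R e B u) v = dot (laplacian e (ext0 u)) (ext0 v).
Proof.
rewrite lfunE; apply: dot_restr => [x|x xB]; first by rewrite ffunE valK.
by rewrite [ext0 v x]ffunE insubN ?mulr0.
Qed.

Lemma Neumann_dot u v :
  dot (Neumann R e B u) v = dot (laplacian e (N0 e u)) (N0 e v).
Proof.
rewrite NeumannE //; have [Nv _] := N0P sym_e conn_e Omega_gt0 v.
have [_ Lu] := N0P sym_e conn_e Omega_gt0 u.
by apply: dot_restr => // x; rewrite negbK => /Lu->; rewrite mul0r.
Qed.

Lemma Dirichlet_selfadjoint : selfadjoint (Dirichlet R e B).
Proof.
by move=> u v; rewrite Dirichlet_dot laplacian_selfadjoint // dotC -Dirichlet_dot dotC.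
Qed.

Lemma Neumann_selfadjoint : selfadjoint (Neumann R e B).
Proof.
by move=> u v; rewrite Neumann_dot laplacian_selfadjoint // dotC -Neumann_dot dotC.
Qed.

Lemma selfadjointB (T Q : 'End(X)) :
  selfadjoint T -> selfadjoint Q -> selfadjoint (T - Q).
Proof.
move=> symT symQ u v; rewrite !add_lfunE !opp_lfunE dotBl dotBr.
by rewrite symT symQ.
Qed.

(** With f the solution of [L_B e f = A_Omega e u], the Neumann extension of [u] is
    [ext0 u + ext0 f]; on the interior the Laplacian of the second summand is [- A_B e f]. *)
Lemma ALA_E : ALA R e B = Dirichlet R e B - Neumann R e B.
Proof.
apply/lfunP => u; rewrite add_lfunE opp_lfunE !comp_lfunE NeumannE // !lfunE /=.
set f := (_^-1)%VF _.
have Lf : L_B e f = A_Omega e u.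
  by rewrite -[LHS]lfunE lker0_lfunVK ?lker_L_B // lfunE.
have -> : neumann_laplacian e u = restr _ (laplacian e (ext0 u + ext0 f)).
  congr restr; congr laplacian.
  apply: (is_neumann_ext_unique sym_e conn_e Omega_gt0).
    exact: (N0P sym_e conn_e Omega_gt0 u).
  split=> [x|x xB].
    by rewrite !ffunE valK insubN ?addr0 // (valP x).
  rewrite linearD ffunE laplacian_ext0_out ?negbK //.
  have /ffunP/(_ (Sub x xB)) := Lf; rewrite !ffunE /= => ->.
  by rewrite addNr.
rewrite /dirichlet_laplacian !linearD /= addrA subrr add0r.
apply/ffunP => x; rewrite [LHS]ffunE [RHS]ffunE [restr _ _ x]ffunE.
by rewrite (laplacian_ext0_out e f (valP x)) opprK.
Qed.

Lemma DegI_selfadjoint : selfadjoint (DegI R e B).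
Proof.
move=> u v; rewrite !lfunE; apply: eq_bigr => x _ /=.
by rewrite !ffunE mulrCA mulrA.
Qed.

(** Neighbours in the interior give the induced Laplacian; each neighbour in [B], where the
    extension is 0, contributes [u x]. *)
Lemma DirichletE u :
  Dirichlet R e B u = laplacian (induced_Omega e B) u + DegI R e B u.
Proof.
rewrite !lfunE; apply/ffunP => x; rewrite !ffunE valK /=.
rewrite (bigID (mem B)) /= addrC; congr (_ + _).
  rewrite -sum_sub; apply: eq_bigr => y _; rewrite !ffunE valK.
  by [].
rewrite /Deg_B mulr_suml; apply: eq_bigr => y yB.
by rewrite ffunE insubN ?negbK //= subr0 mulrC.
Qed.

(** Fiedler's bound applies to [N0 e u] on the whole graph, and the norm of [N0 e u] is at least
    that of [u], which it extends. *)
Lemma Neumann_form u : \sum_x N0 e u x = 0 ->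
  2 * (edge_connectivity e)%:R * (1 - cos (pi / #|V|%:R)) * dot u u
    <= dot (Neumann R e B u) u.
Proof.
move=> Nu0; rewrite Neumann_dot.
apply: le_trans (fiedler_laplacian sym_e Nu0); apply: ler_wpM2l.
  exact: edge_constant_ge0.
have [Nu _] := N0P sym_e conn_e Omega_gt0 u.
rewrite /dot [leRHS](bigID (fun x => x \notin B)) /=.
rewrite -(sum_sub (fun x => x \notin B) (fun x => N0 e u x * N0 e u x)).
under [X in _ <= X + _]eq_bigr do rewrite Nu.
by rewrite lerDl sumr_ge0 // => x _; rewrite -expr2 sqr_ge0.
Qed.

Lemma Dirichlet_form u : \sum_x u x = 0 ->
  2 * (edge_connectivity (induced_Omega e B))%:R
    * (1 - cos (pi / #|Omega B|%:R)) * dot u u + dot (DegI R e B u) u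
  <= dot (Dirichlet R e B u) u.
Proof.
move=> u0; rewrite DirichletE dotDl lerD2r fiedler_laplacian //.
by move=> x y; rewrite /induced_Omega /induced sym_e.
Qed.

Lemma N0_mean_linear : linear (fun u => \sum_x N0 e u x : R^o).
Proof.
move=> a u v; rewrite N0_linear // scaler_sumr -big_split.
by apply: eq_bigr => x _; rewrite !ffunE.
Qed.

Lemma mean_linear : linear (fun u => \sum_x u x : R^o).
Proof.
move=> a u v; rewrite scaler_sumr -big_split.
by apply: eq_bigr => x _; rewrite !ffunE.
Qed.

(** The test space consists of the functions that vanish where [Deg_B] is below its [j]-th value;
    this imposes at most [j - 1] conditions. *)
Lemma eigval_DegI (j : nat) : (1 <= j <= #|Omega B|)%N ->
  Deg_B_sorted R e B j <= eigval (DegI R e B) j.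
Proof.
move=> jI; set c := Deg_B_sorted R e B j.
pose P : pred (Omega B) := fun x => Deg_B R e x < c.
apply: (eigval_ge_subspace (U := lker (linfun (@restr R _ P)))) => //.
- exact: DegI_selfadjoint.
- apply: leq_ltn_trans (dim_lker (linfun (@restr R _ P))) _; rewrite ltn_add2l dim_ffun card_sig.
  have : (#|P| <= j.-1)%N.
    pose s := sort <=%R [seq Deg_B R e x | x : Omega B].
    have sorted_s : sorted <=%R s by exact: (sort_sorted le_total).
    apply: leq_trans (count_lt_sorted _ sorted_s).
    rewrite count_sort count_map cardE [enum P]/enum_mem size_filter -enumT.
    exact: sub_count.
  by case/andP: jI => j0 _; rewrite -ltnS prednK.
move=> u; rewrite memv_ker lfunE /= => /eqP uP; rewrite lfunE /=.
rewrite /dot mulr_sumr; apply: ler_sum => x _; rewrite ffunE -mulrA.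
have [xc|cx] := ltP (Deg_B R e x) c.
  by have /ffunP/(_ (Sub x xc)) := uP; rewrite !ffunE /= => ->; rewrite !mulr0.
by rewrite ler_wpM2r // -expr2 sqr_ge0.
Qed.

End Operators.

Theorem theorem6p4 (R : realType) (V : finType) (e : rel V) (B : {set V})
    (sym_e : symmetric e) (irr_e : irreflexive e)
    (conn_e : connected_graph e) (B_neq0 : B != set0)
    (i : nat) (hi : (2 <= i <= #|Omega B|)%N) :
  [/\ eigval (Neumann R e B) 2
        >= 2 * (edge_connectivity e)%:R * (1 - cos (pi / #|V|%:R)),
      eigval (Neumann R e B) i
        >= 2 * (edge_connectivity (induced_Omega e B))%:R
             * (1 - cos (pi / #|Omega B|%:R))
           + eigval (DegI R e B - ALA R e B) i.-1,
      eigval (Dirichlet R e B) i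
        >= 2 * (edge_connectivity (induced_Omega e B))%:R
             * (1 - cos (pi / #|Omega B|%:R))
           + Deg_B_sorted R e B i.-1
    & eigval (Dirichlet R e B) i
        >= 2 * (edge_connectivity e)%:R * (1 - cos (pi / #|V|%:R))
           + eigval (ALA R e B) i.-1].
Proof.
have Omega_gt0 : (0 < #|Omega B|)%N by lia.
have symN := @Neumann_selfadjoint R V e B sym_e conn_e Omega_gt0.
have symD := @Dirichlet_selfadjoint R V e B sym_e.
have symQ := @DegI_selfadjoint R V e B.
have ALAE := @ALA_E R V e B sym_e conn_e Omega_gt0.
have symA : selfadjoint (ALA R e B) by rewrite ALAE; apply: selfadjointB.
have [gN gNE] := linear_lfun (@N0_mean_linear R V e B sym_e conn_e Omega_gt0).
have [g gE] := linear_lfun (@mean_linear R V B).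
have in_gN u : u \in lker gN -> \sum_x N0 e u x = 0.
  by rewrite memv_ker gNE => /eqP.
have in_g u : u \in lker g -> \sum_x u x = 0.
  by rewrite memv_ker gE => /eqP.
(* The identity [ALA = Dirichlet - Neumann], applied to [u] and paired with [u]. *)
have Dform u := congr1 (fun w => dot w u) (congr1 (fun T : 'End(_) => T u) ALAE).
split.
- apply: (eigval_ge_subspace (U := lker gN)) => //; first lia.
    exact: dim_lker_functional.
  by move=> u /in_gN; apply: Neumann_form.
(* Subtracting the form of [ALA] from both sides of the Dirichlet bound gives the Neumann bound with
   [Q = DegI - ALA]. *)
- apply: (eigval_ge_perturb (g := g)) => //; first exact: selfadjointB.
  move=> u /in_g/(Dirichlet_form sym_e); have := Dform u.
  rewrite !add_lfunE !opp_lfunE !dotBl; lra.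
- have i1 : (1 <= i.-1 <= #|Omega B|)%N by lia.
  have Deg_le := @eigval_DegI R V e B i.-1 i1.
  apply: le_trans (lerD (lexx _) Deg_le) _.
  apply: (eigval_ge_perturb (g := g)) => // u /in_g.
  exact: Dirichlet_form.
(* Here the form of [ALA] is added to the Neumann bound, so the functional is the mean of [N0 e u]
   over [V]. *)
- apply: (eigval_ge_perturb (g := gN)) => // u /in_gN.
  move=> /(Neumann_form sym_e conn_e Omega_gt0); have := Dform u.
  rewrite !add_lfunE !opp_lfunE !dotBl; lra.
Qed.
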